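(* The pair $A,A^*$ acts on each irreducible $T$-module $W$ as a Leonard pair.
   Context: Let $\mathbb F_q$ be a finite field with $q$ elements, let $N,M$ be positive integers, let $H$ be a vector space over $\mathbb F_q$ of dimension $N+M$, and fix a subspace $h\subseteq H$ of dimension $M$. Let $X$ be the set of subspaces $y\subseteq H$ with $y\cap h=0$, partially ordered by inclusion (the Attenuated Space poset $\mathcal A_q(N,M)$). For $y,z\in X$, $z$ covers $y$ when $y\subseteq z$ and $\dim z-\dim y=1$; $y,z$ are adjacent when one of them covers the other. Let $\mathrm{Mat}_X(\mathbb C)$ be the algebra of complex matrices with rows and columns indexed by $X$, acting on $V=\mathbb C^X$ by left multiplication. The matrix $A\in\mathrm{Mat}_X(\mathbb C)$ has $(y,z)$-entry $1$ if $y$ covers $z$; $q^{\dim y}$ if $z$ covers $y$; and $0$ if $y,z$ are not adjacent. The matrix $A^*\in\mathrm{Mat}_X(\mathbb C)$ is diagonal with $(y,y)$-entry $q^{-\dim y}$. Let $T$ be the subalgebra of $\mathrm{Mat}_X(\mathbb C)$ generated by $A,A^*$. A $T$-module is a subspace $W\subseteq V$ with $TW\subseteq W$; it is irreducible when $W\ne0$ and $W$ contains no $T$-module besides $0$ and $W$. A square matrix is tridiagonal when each nonzero entry lies on the diagonal, the subdiagonal, or the superdiagonal; a tridiagonal matrix is irreducible when every entry on the subdiagonal and every entry on the superdiagonal is nonzero. Let $W$ be a vector space of finite positive dimension. A Leonard pair on $W$ is an ordered pair of linear maps $B,B^*:W\to W$ such that (i) there is a basis of $W$ with respect to which the matrix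 representing $B$ is irreducible tridiagonal and the matrix representing $B^*$ is diagonal; (ii) there is a basis of $W$ with respect to which the matrix representing $B^*$ is irreducible tridiagonal and the matrix representing $B$ is diagonal. *)

(* Defs.v *)
From HB Require Import structures.
From mathcomp Require Import all_boot all_order all_algebra.
From mathcomp Require Import complex.
From mathcomp Require Import reals.

Set Implicit Arguments.
Unset Strict Implicit.
Unset Printing Implicit Defensive.

Import GRing.Theory.
Local Open Scope ring_scope.

(* A subspace is encoded by a matrix over the base field, so the subspaces of  *)
(* a vector space over a finite field form a finite type.                      *)
HB.instance Definition _ (F : finFieldType) (H : vectType F) :
    isCountable {vspace H} :=
  CanIsCountable (@VectorInternalTheory.vs2mxK F H).
HB.instance Definition _ (F : finFieldType) (H : vectType F) :
    isFinite {vspace H} :=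
  CanIsFinite (@VectorInternalTheory.vs2mxK F H).

Section AttenuatedSpace.
Variables (F : finFieldType) (H : vectType F) (h : {vspace H}).

Definition attSpace := {y : {vspace H} | (y :&: h == 0)%VS}.

HB.instance Definition _ := SubChoice.on attSpace.
HB.instance Definition _ := Finite.on attSpace.

Definition covers (z y : attSpace) : bool :=
  (val y <= val z)%VS && (\dim (val z) == (\dim (val y)).+1).

(* 'M[C]_#|attSpace| is Mat_X(C): indices correspond to elements of X through  *)
(* the bijection enum_val : 'I_#|X| -> X.                                      *)
Definition att_mx (C : fieldType) : 'M[C]_#|{: attSpace}| :=
  \matrix_(i, j)
    let y := enum_val i in let z := enum_val j in
    if covers y z then 1
    else if covers z y then #|F|%:R ^+ \dim (val y)
    else 0.

Definition att_dual_mx (C : fieldType) : 'M[C]_#|{: attSpace}| :=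
  \matrix_(i, j)
    if i == j then #|F|%:R ^- \dim (val (enum_val i : attSpace)) else 0.

End AttenuatedSpace.

Section Modules.
Variables (C : fieldType) (n : nat).

Inductive gen_subalg (S : 'M[C]_n -> Prop) : 'M[C]_n -> Prop :=
| gen_subalg_gen B : S B -> gen_subalg S B
| gen_subalg_1 : gen_subalg S 1%:M
| gen_subalg_lin a B D :
    gen_subalg S B -> gen_subalg S D -> gen_subalg S (a *: B + D)
| gen_subalg_mul B D :
    gen_subalg S B -> gen_subalg S D -> gen_subalg S (B *m D).

Definition is_module (T : 'M[C]_n -> Prop) (W : {vspace 'cV[C]_n}) : Prop :=
  forall B, T B -> forall w, w \in W -> B *m w \in W.

Definition irreducible_module (T : 'M[C]_n -> Prop) (W : {vspace 'cV[C]_n}) :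
    Prop :=
  [/\ is_module T W, W <> 0%VS &
      forall U : {vspace 'cV[C]_n},
        (U <= W)%VS -> is_module T U -> U = 0%VS \/ U = W].

(* The map w |-> B *m w on W, composed with the projection vsproj W, which is  *)
(* harmless when W is stable under B (see action_onE).                         *)
Definition action_on (W : {vspace 'cV[C]_n}) (B : 'M[C]_n) :
    'End(subvs_of W) :=
  (linfun (@vsproj C 'cV[C]_n W) \o linfun (@mulmx C n n 1 B)
   \o linfun (@vsval C 'cV[C]_n W))%VF.

Lemma action_onE (W : {vspace 'cV[C]_n}) (B : 'M[C]_n) (w : subvs_of W) :
  B *m vsval w \in W -> vsval (action_on W B w) = B *m vsval w.
Proof. by move=> BwW; rewrite /action_on !comp_lfunE !lfunE /= vsprojK. Qed.

End Modules.

Section LeonardPairs.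
Variables (K : fieldType) (W : vectType K).

Definition tridiagonal n (B : 'M[K]_n) : Prop :=
  forall i j : 'I_n, B i j != 0 ->
    [\/ i = j :> nat, i = j.+1 :> nat | j = i.+1 :> nat].

Definition irred_tridiagonal n (B : 'M[K]_n) : Prop :=
  tridiagonal B /\
  forall i j : 'I_n, i = j.+1 :> nat \/ j = i.+1 :> nat -> B i j != 0.

(* Column convention: f e_j = \sum_i (repr_mx e f)_ij e_i. The library's mxof  *)
(* is the transpose.                                                           *)
Definition repr_mx n (e : n.-tuple W) (f : 'End(W)) : 'M[K]_n :=
  \matrix_(i, j) coord e i (f e`_j).

Definition leonard_pair (B Bs : 'End(W)) : Prop :=
  [/\ (0 < \dim {:W})%N,
      exists e : (\dim {:W}).-tuple W,
        [/\ basis_of {:W} e, irred_tridiagonal (repr_mx e B)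
          & is_diag_mx (repr_mx e Bs)] &
      exists e : (\dim {:W}).-tuple W,
        [/\ basis_of {:W} e, irred_tridiagonal (repr_mx e Bs)
          & is_diag_mx (repr_mx e B)]].

End LeonardPairs.

(* Main.v *)
Require Import Defs.
From HB Require Import structures.
From mathcomp Require Import all_boot all_order all_algebra.
From mathcomp Require Import complex.
From mathcomp Require Import reals.
From mathcomp Require Import finfield spectral zify ring.

(* Write [A = R + L], with [R] the raising part and [L] the weighted lowering  *)
(* part, and [K] for A*.  Counting paths of length three in the Hasse diagram  *)
(* gives [L R^2 = q (q + 1) R L R - q^3 R^2 L - (q + 1) q^(N + M) R], which is *)
(* Terwilliger's uniform poset condition.  An irreducible module is thus       *)
(* spanned by the vectors [R^j w] for a single lowest weight vector [w]; the   *)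
(* coefficients of [L] on this basis solve a linear recurrence and are fixed   *)
(* by the dimension [d + 1] alone.  After rescaling, the module becomes the    *)
(* space of polynomials of degree at most [d] in [t], with [A] acting as a     *)
(* first order q-difference operator and [K] as the rescaling [t -> t / q].    *)
(* The eigenvectors of [A] are then explicit products of linear factors        *)
(* (dual q-Krawtchouk), on which [K] acts by a three-term relation.            *)

(** The geometry enters through [lowering_raising_cubic]: its entries compare the counts of
    [path_up_up_down], [path_up_down_up] and [path_down_up_up], and its term linear in R comes from
    [upnum_step], the drop in the number of upper covers from one rank to the next.

    The rest is linear algebra. A module is stable under R and L separately ([Rm_stable],
    [Lm_stable]). A vector of lowest K-weight that is also an eigenvector of L R generates W
    ([lowest_weight_vector], [span_rvec]), and the vanishing of R^(d+1) on it fixes the remaining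
    parameter ([tauE]). Up to two scalars this leaves one model for each d, and
    [dual_krawtchouk_leonard_pair] exhibits its two bases: the monomials, and the polynomials
    [krawp k] for k <= d. *)

Set Implicit Arguments.
Unset Strict Implicit.
Unset Printing Implicit Defensive.

Import Order.TTheory GRing.Theory Num.Theory.
Local Open Scope ring_scope.

(** * Counting subspaces *)

Section SubspaceCounting.
Variables (F : finFieldType) (H : vectType F).
Implicit Types (a b u v w y z : {vspace H}).
Local Notation q := #|F|.

Lemma card_mem_vspace u :
  #|[set x : finvect_type H | x \in u]| = (q ^ \dim u)%N.
Proof.
(* Unpacking [H] lets its vector structure [c] be reused on the finite carrier [finvect_type], where
   [card_vspace] applies. *)
rewrite cardsE; case: H u => T c u.
rewrite -(@card_vspace F (finvect_type (Vector.Pack c)) c u).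
by apply: eq_card => x.
Qed.

Lemma vline_dim_add a (x : H) : \dim (a + <[x]>)%VS = ((x \notin a) + \dim a)%N.
Proof.
case: (boolP (x \in a)) => [xa|xNa] /=.
  by rewrite (addv_idPl _) // -memvE.
have x0 : x != 0 by apply: contraNneq xNa => ->; rewrite mem0v.
rewrite dimv_disjoint_sum ?dim_vline ?x0 1?addnC //.
apply/eqP; rewrite -subv0; apply/subvP => z.
rewrite memv_cap => /andP[za /vlineP[k zE]].
by move: za; rewrite zE rpredZeq (negPf xNa) orbF => /eqP->; rewrite scale0r mem0v.
Qed.

Lemma dimv_cap_lt a b : ~~ (a <= b)%VS -> (\dim (a :&: b) < \dim a)%N.
Proof.
move=> aNb; rewrite ltn_neqAle dimvS ?capvSl // andbT.
apply: contra aNb => /eqP e; apply/capv_idPl/eqP.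
by rewrite eqEdim capvSl e leqnn.
Qed.

Definition vcover u a := (a <= u)%VS && (\dim u == (\dim a).+1).

Lemma vcover_line a (x : H) : vcover (a + <[x]>)%VS a = (x \notin a).
Proof.
rewrite /vcover addvSl vline_dim_add /= -[(\dim a).+1]add1n eqn_add2r.
by case: (x \notin a).
Qed.

Lemma vcover_eq_line u a (x : H) :
  vcover u a -> x \in u -> x \notin a -> (a + <[x]>)%VS = u.
Proof.
move=> /andP[au /eqP du] xu xa; apply/eqP; rewrite eqEdim subv_add au -memvE xu /=.
by rewrite vline_dim_add xa du.
Qed.

(** Double counting: a vector x outside a determines the cover a + <x>, and a cover u arises from
    each of the vectors in u but not in a. The product form avoids a division. *)
Lemma card_vcover_mul a (P : pred {vspace H}) :
  (#|[set u | vcover u a & P u]| * (q ^ (\dim a).+1 - q ^ \dim a)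
   = #|[set x : finvect_type H | (x \notin a) && P (a + <[x : H]>)%VS]|)%N.
Proof.
rewrite -[RHS]sum1dep_card.
rewrite (partition_big (fun x : finvect_type H => (a + <[x : H]>)%VS)
   (fun u => vcover u a && P u)) /=; last first.
  by move=> x /andP[xa Px]; rewrite vcover_line xa.
rewrite -sum_nat_const; apply: eq_big => [u|u]; rewrite inE // => /andP[uC Pu].
rewrite sum1dep_card.
have /andP[au /eqP du] := uC.
rewrite -du -!card_mem_vspace -cardsDS; last first.
  by apply/subsetP => x; rewrite !inE; apply: subvP.
apply: eq_card => x; rewrite !inE; case: (boolP (x \in a)) => //= xa.
apply/idP/andP => [xu|[_ /eqP <-]]; last first.
  by rewrite (subvP (addvSr a _)) // memv_line.
by rewrite (vcover_eq_line uC).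
Qed.

Lemma card_field_gt1 : (1 < q)%N.
Proof. exact: finNzRing_gt1. Qed.

Lemma expq_step_gt0 n : (0 < q ^ n.+1 - q ^ n)%N.
Proof. by rewrite subn_gt0 ltn_exp2l // card_field_gt1. Qed.

(** These covers are the points of the projective line of b / a. *)
Lemma card_vcover_interval a b :
  (a <= b)%VS -> \dim b = (\dim a).+2 ->
  #|[set u | vcover u a & (u <= b)%VS]| = q.+1.
Proof.
move=> ab db; apply/eqP; rewrite -(eqn_pmul2r (expq_step_gt0 (\dim a))).
rewrite card_vcover_mul.
have -> : [set x : finvect_type H | (x \notin a) && (a + <[x : H]> <= b)%VS] =
   [set x : finvect_type H | x \in b] :\: [set x : finvect_type H | x \in a].
  by apply/setP => x; rewrite !inE subv_add ab -memvE.
rewrite cardsDS; last by apply/subsetP => x; rewrite !inE; apply: subvP.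
rewrite !card_mem_vspace db !expnS; have := card_field_gt1.
by move: (q ^ _)%N => e q1; apply/eqP; nia.
Qed.

(** For x outside z, the sum z + <x> avoids h exactly when x lies outside z + h. *)
Lemma card_vcover_disjoint z (h : {vspace H}) : (z :&: h == 0)%VS ->
  (#|[set u | vcover u z & (u :&: h == 0)%VS]| * (q ^ (\dim z).+1 - q ^ \dim z)
   = q ^ \dim {:H} - q ^ (\dim z + \dim h))%N.
Proof.
move=> zh; rewrite card_vcover_mul -dimv_disjoint_sum; last exact/eqP.
rewrite -!card_mem_vspace -cardsDS; last first.
  by apply/subsetP => x _; rewrite inE; exact: (memvf (x : H)).
apply: eq_card => x; rewrite !inE (memvf (x : H)) andbT.
have := dimv_sum_cap (z + <[x : H]>)%VS h.
rewrite -addvA [(<[_]> + h)%VS]addvC addvA !vline_dim_add.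
rewrite dimv_disjoint_sum; last exact/eqP.
rewrite -dimv_eq0.
have : (x : H) \notin (z + h)%VS -> (x : H) \notin z.
  by apply: contra; apply/subvP/addvSl.
case: (_ \notin _) (_ \notin _) => [] [] //=;
  move: (\dim (_ :&: _)) => [|n] //= _; lia.
Qed.

End SubspaceCounting.

(** * Paths of length three in the Hasse diagram *)

Section Paths.
Variables (F : finFieldType) (H : vectType F) (h : {vspace H}).
Local Notation q := #|F|.
Local Notation X := (attSpace h).
Implicit Types u v w y z : X.

Lemma disjointS (s t : {vspace H}) :
  (s <= t)%VS -> (t :&: h == 0)%VS -> (s :&: h == 0)%VS.
Proof.
by move=> st; rewrite -!subv0; apply: subv_trans; apply: capvS.
Qed.

Definition aval (u : X) : {vspace H} := val u.

Lemma attP u : (aval u :&: h == 0)%VS. Proof. exact: (valP u). Qed.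

Lemma aval_inj : injective aval. Proof. exact: val_inj. Qed.

Definition mkatt (s : {vspace H}) (sh : (s :&: h == 0)%VS) : X := exist _ s sh.

Lemma mkattK s (sh : (s :&: h == 0)%VS) : aval (mkatt sh) = s. Proof. by []. Qed.

Lemma card_att (P : pred {vspace H}) :
  #|[set u : X | P (aval u)]| = #|[set s | P s & (s :&: h == 0)%VS]|.
Proof.
rewrite -(card_imset _ aval_inj); apply: eq_card => s; rewrite inE.
apply/imsetP/andP => [[u]|[Ps hs]].
  by rewrite inE => Pu ->; split; last exact: attP.
by exists (mkatt hs) => //; rewrite inE.
Qed.

Lemma coversE u z : Defs.covers u z = vcover (aval u) (aval z).
Proof. by []. Qed.

Local Notation covers u z := (vcover (aval u) (aval z)).

Definition upnum z := #|[set u | covers u z]|.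

Lemma upnum_mul z :
  (upnum z * (q ^ (\dim (aval z)).+1 - q ^ \dim (aval z))
   = q ^ \dim {:H} - q ^ (\dim (aval z) + \dim h))%N.
Proof. by rewrite -(card_vcover_disjoint (attP z)) -card_att. Qed.

Lemma sum_interval w v : (aval w <= aval v)%VS ->
  \dim (aval v) = (\dim (aval w)).+2 ->
  (\sum_u covers u w * covers v u)%N = q.+1.
Proof.
move=> wv dv; rewrite -(card_vcover_interval wv dv).
have -> : #|[set u | vcover u (aval w) & (u <= aval v)%VS]| =
   #|[set s | (vcover s (aval w) && (s <= aval v)%VS) & (s :&: h == 0)%VS]|.
  apply: eq_card => s; rewrite !inE.
  case: (boolP (s <= _)%VS) => [sv|]; last by rewrite andbF.
  by rewrite (disjointS sv (attP v)) !andbT.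
rewrite -(card_att (fun s => vcover s (aval w) && (s <= aval v)%VS)).
rewrite -sum1dep_card [RHS]big_mkcond /=; apply: eq_bigr => u _.
rewrite /vcover dv.
case: (boolP (_ <= _)%VS) => //= _.
by case: eqP => [->|] //=; rewrite eqxx andbT mul1n; case: (_ <= _)%VS.
Qed.

Lemma sum_nat_eq1 (T : finType) (t : T) (b : T -> bool) :
  (forall s, b s = (s == t)) -> (\sum_s b s = 1)%N.
Proof.
by move=> bE; rewrite (bigD1 t) //= bE eqxx big1 // => s /negPf sNt; rewrite bE sNt.
Qed.

Definition common_down z y : nat :=
  \sum_w (covers z w && (aval w <= aval y)%VS).

Definition joinable z y : bool :=
  ~~ (aval z <= aval y)%VS && ((aval z + aval y) :&: h == 0)%VS.

(** The only candidate is the intersection of z and y. *)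
Lemma common_down_not_le z y : ~~ (aval z <= aval y)%VS ->
  common_down z y = ((\dim (aval z :&: aval y)%VS).+1 == \dim (aval z)).
Proof.
move=> zNy; have dlt := dimv_cap_lt zNy.
case: eqP => dcap; last first.
  apply: big1 => w _; case: andP => // -[/andP[wz /eqP dw] wy].
  exfalso; have := @dimvS _ _ (aval w) (aval z :&: aval y)%VS.
  by rewrite subv_cap wz wy => /(_ isT); lia.
have hw : ((aval z :&: aval y) :&: h == 0)%VS.
  by apply: disjointS (attP z); apply: capvSl.
pose w0 := mkatt hw.
apply: (@sum_nat_eq1 X w0) => w.
apply/idP/eqP => [/andP[/andP[wz /eqP dw] wy]|->].
  by apply/aval_inj/eqP; rewrite eqEdim subv_cap wz wy -ltnS dcap dw /=.
by rewrite /vcover mkattK capvSl capvSr -dcap eqxx.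
Qed.

(** For a fixed v the interval from z to v offers q + 1 choices of u. If z is inside y, then v is
    any cover of y; otherwise v must be z + y, which has to avoid h and exceed y by one
    dimension. *)
Lemma path_up_up_down z y : \dim (aval y) = (\dim (aval z)).+1 ->
  (\sum_v \sum_u covers u z * covers v u * covers v y
   = q.+1 * ((aval z <= aval y)%VS * upnum y + joinable z y * common_down z y))%N.
Proof.
move=> dy.
transitivity (q.+1 * \sum_v (covers v y && (aval z <= aval v)%VS))%N.
  rewrite big_distrr /=; apply: eq_bigr => v _.
  rewrite -big_distrl /=; case: (boolP (covers v y)) => [vy|]; last by rewrite !muln0.
  have dv : \dim (aval v) = (\dim (aval z)).+2 by case/andP: vy => _ /eqP ->; rewrite dy.
  rewrite muln1; case: (boolP (_ <= _)%VS) => zv; first by rewrite sum_interval // muln1.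
  rewrite muln0; apply: big1 => u _; apply/eqP; rewrite muln_eq0 !eqb0 -negb_and.
  by apply: contra zv => /andP[/andP[zu _] /andP[uv _]]; apply: subv_trans uv.
congr (_ * _)%N; rewrite /joinable; case: (boolP (_ <= _)%VS) => zy.
  rewrite mul1n mul0n addn0 /upnum -sum1dep_card [RHS]big_mkcond /=.
  apply: eq_bigr => v _; case: (boolP (covers v y)) => // /andP[yv _].
  by rewrite (subv_trans zy yv).
rewrite mul0n add0n /= common_down_not_le //.
have dsum := dimv_sum_cap (aval z) (aval y).
case: (boolP (_ == _)) => [hzy|nzy]; last first.
  apply: big1 => v _; case: andP => // -[/andP[yv _] zv].
  by case/negP: nzy; apply: disjointS (attP v); rewrite subv_add zv.
rewrite mul1n; case: eqP => dcap; last first.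
  apply: big1 => v _; case: andP => // -[/andP[yv /eqP dv] zv]; exfalso.
  have := @dimvS _ _ (aval z + aval y)%VS (aval v).
  rewrite subv_add zv yv => /(_ isT).
  by have := dimv_cap_lt zy; lia.
pose v0 := mkatt hzy.
apply: (@sum_nat_eq1 X v0) => v.
apply/idP/eqP => [/andP[/andP[yv /eqP dv] zv]|->].
  apply/aval_inj/eqP; rewrite mkattK eq_sym eqEdim subv_add yv zv /=; lia.
by rewrite /vcover mkattK addvSl addvSr /=; apply/eqP; lia.
Qed.

Lemma path_down_up_up z y : \dim (aval y) = (\dim (aval z)).+1 ->
  (\sum_v \sum_u covers z u * covers v u * covers y v
   = q.+1 * common_down z y)%N.
Proof.
move=> dy; rewrite exchange_big big_distrr /=; apply: eq_bigr => u _.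
under eq_bigr => v _ do rewrite -mulnA.
rewrite -big_distrr /=; case: (boolP (covers z u)) => [zu|]; last by rewrite muln0.
have du : \dim (aval y) = (\dim (aval u)).+2 by case/andP: zu => _ /eqP <-; rewrite dy.
rewrite mul1n; case: (boolP (_ <= _)%VS) => uy; first by rewrite sum_interval // muln1.
rewrite muln0; apply: big1 => v _; apply/eqP; rewrite muln_eq0 !eqb0 -negb_and.
by apply: contra uy => /andP[/andP[uv _] /andP[vy _]]; apply: subv_trans vy.
Qed.

(** By the dimension formula, z + v is one dimension larger than z exactly when the intersection of
    z and v is one smaller, so both sums are 0 or 1. Only z + v can fail to lie in the poset, by
    meeting h. *)
Lemma sum_up_down z v : z != v -> \dim (aval v) = \dim (aval z) ->
  (\sum_(u : X) covers u z * covers u v =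
   ((aval z + aval v) :&: h == 0)%VS * \sum_(w : X) covers z w * covers v w)%N.
Proof.
move=> zv dv; have capd : (\dim (aval z :&: aval v) < \dim (aval z))%N.
  apply: dimv_cap_lt; apply: contra zv => zv; apply/eqP/aval_inj/eqP.
  by rewrite eqEdim zv dv leqnn.
have dsum := dimv_sum_cap (aval z) (aval v).
case: (eqVneq (\dim (aval z + aval v)%VS) (\dim (aval z)).+1) => [ds|ds]; last first.
  rewrite !big1 ?muln0 // => u _; apply/eqP; rewrite muln_eq0 !eqb0 -negb_and.
    apply/negP => /andP[/andP[uz /eqP dz] /andP[uv _]].
    have := @dimvS _ _ (aval u) (aval z :&: aval v)%VS.
    by rewrite subv_cap uz uv => /(_ isT); move/eqP: ds; lia.
  apply/negP => /andP[/andP[zu /eqP du] /andP[vu _]].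
  have := @dimvS _ _ (aval z + aval v)%VS (aval u).
  by rewrite subv_add zu vu => /(_ isT); move/eqP: ds; lia.
have -> : (\sum_(w : X) covers z w * covers v w = 1)%N.
  have hw : ((aval z :&: aval v) :&: h == 0)%VS.
    by apply: disjointS (attP z); apply: capvSl.
  under eq_bigr => w _ do rewrite mulnb.
  apply: (@sum_nat_eq1 X (mkatt hw)) => w.
  apply/idP/eqP => [/andP[/andP[wz /eqP dw] /andP[wv _]]|->].
    apply/aval_inj/eqP; rewrite mkattK eqEdim subv_cap wz wv /=; lia.
  by rewrite /vcover mkattK capvSl capvSr /=; apply/andP; split; apply/eqP; lia.
rewrite muln1; case: (boolP (_ == _)) => [hzv|nzv]; last first.
  apply: big1 => u _; apply/eqP; rewrite muln_eq0 !eqb0 -negb_and.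
  apply: contra nzv => /andP[/andP[zu _] /andP[vu _]].
  by apply: disjointS (attP u); rewrite subv_add zu.
under eq_bigr => u _ do rewrite mulnb.
apply: (@sum_nat_eq1 X (mkatt hzv)) => u.
apply/idP/eqP => [/andP[/andP[zu /eqP du] /andP[vu _]]|->].
  by apply/aval_inj/eqP; rewrite mkattK eq_sym eqEdim subv_add zu vu ds du /=.
by rewrite /vcover mkattK addvSl addvSr dv ds eqxx.
Qed.

(* If [z + y] meets [h], it does so in a line [l], and [z + v] contains [l]    *)
(* only for [v = (z + l) :&: y].                                               *)
Lemma sum_not_disjoint z y w :
  covers z w -> (aval w <= aval y)%VS -> ~~ (aval z <= aval y)%VS ->
  \dim (aval y) = (\dim (aval z)).+1 -> ((aval z + aval y) :&: h != 0)%VS ->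
  (\sum_(v : X) (covers v w && covers y v && ((aval z + aval v) :&: h != 0)%VS)
   = 1)%N.
Proof.
move=> /andP[wz /eqP dz] wy zNy dy nzy.
have capE : (aval z :&: aval y)%VS = aval w.
  have zv := dimv_cap_lt zNy.
  apply/esym/eqP; rewrite eqEdim subv_cap wz wy /=; lia.
have dsum := dimv_sum_cap (aval z) (aval y); rewrite capE in dsum.
set l := ((aval z + aval y) :&: h)%VS in nzy.
have lh s : (s <= h)%VS -> forall u, (aval u :&: s)%VS = 0%VS.
  move=> sh u; apply/eqP; rewrite -subv0.
  by apply: subv_trans (capvS (subvv (aval u)) sh) _; rewrite subv0 attP.
have lSh : (l <= h)%VS by apply: capvSr.
(* y and l are independent inside z + y, which is only one dimension larger than y. *)
have dl : \dim l = 1%N.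
  have yl := dimv_disjoint_sum (lh l lSh y).
  have := @dimvS _ _ (aval y + l)%VS (aval z + aval y)%VS.
  rewrite subv_add addvSr capvSl yl => /(_ isT).
  by move: nzy; rewrite -dimv_eq0; lia.
have dzl := dimv_disjoint_sum (lh l lSh z).
have zlS : (aval z + l <= aval z + aval y)%VS by rewrite subv_add addvSl capvSl.
pose s := ((aval z + l) :&: aval y)%VS.
(* Modular law: z + s is the intersection of z + l with z + y. *)
have zs : (aval z + s)%VS = (aval z + l)%VS.
  rewrite addvC /s vspace_modr ?addvSl //.
  by apply/capv_idPl; rewrite [(aval y + _)%VS]addvC.
have ws : (aval w <= s)%VS by rewrite subv_cap wy (subv_trans wz (addvSl _ _)).
have capzs : (aval z :&: s)%VS = aval w.
  apply/eqP; rewrite eqEsubv subv_cap wz ws andbT -capE subv_cap capvSl /=.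
  by rewrite andbT; exact: subv_trans (capvSr (aval z) s) (capvSr _ _).
have ds : \dim s = \dim (aval z).
  by have := dimv_sum_cap (aval z) s; rewrite zs dzl dl capzs; lia.
have hs : (s :&: h == 0)%VS by apply: disjointS (attP y); apply: capvSr.
apply: (@sum_nat_eq1 X (mkatt hs)) => v.
apply/idP/eqP => [/andP[/andP[/andP[wv /eqP dv] /andP[vy _]] zvh]|->]; last first.
  rewrite /vcover mkattK ws capvSr ds dz dy dz !eqxx /= zs -subv0.
  apply: contra nzy => le0; rewrite -subv0; apply: subv_trans le0.
  by rewrite subv_cap addvSr lSh.
apply/aval_inj/eqP; rewrite mkattK eqEdim ds dz dv leqnn andbT subv_cap vy andbT.
have capzv : (aval z :&: aval v)%VS = aval w.
  apply/eqP; rewrite eqEsubv subv_cap wz wv andbT -capE capvS ?subvv //.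
have lE : ((aval z + aval v) :&: h)%VS = l.
  apply/eqP; rewrite eqEdim capvS ?addvS ?subvv //= dl.
  by rewrite lt0n dimv_eq0.
have : (aval z + l == aval z + aval v)%VS.
  rewrite eqEdim subv_add addvSl -lE capvSl /= lE dzl dl.
  have e := dimv_sum_cap (aval z) (aval v); rewrite capzv in e; clear -e dv dz; lia.
by move/eqP=> ->; apply: addvSr.
Qed.

(** There are q + 1 elements v between w and y. If z is inside y, every z + v avoids h, but z itself
    is excluded, leaving q. If z is not inside y and z + y avoids h, all q + 1 count. In the
    remaining case exactly one v fails, by [sum_not_disjoint]. *)
Lemma sum_between_disjoint z y w : \dim (aval y) = (\dim (aval z)).+1 ->
  covers z w ->
  (\sum_(v : X | v != z)
     covers v w * covers y v * ((aval z + aval v) :&: h == 0)%VS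
   = (aval w <= aval y)%VS * (q + joinable z y))%N.
Proof.
move=> dy cw; have /andP[wz /eqP dz] := cw.
have dyw : \dim (aval y) = (\dim (aval w)).+2 by rewrite dy dz.
case: (boolP (aval w <= _)%VS) => wy; last first.
  rewrite mul0n big1 // => v _; apply/eqP; rewrite muln_eq0; apply/orP; left.
  rewrite muln_eq0 !eqb0 -negb_and; apply: contra wy => /andP[/andP[wv _] /andP[vy _]].
  exact: subv_trans vy.
have tot := sum_interval wy dyw.
rewrite mul1n /joinable; case: (boolP (aval z <= _)%VS) => zy /=.
  move: tot; rewrite (bigD1 z) //= cw /(vcover (aval y) _) zy dy eqxx /=.
  rewrite mul1n add1n => -[<-]; rewrite addn0; apply: eq_bigr => v _.
  case: (boolP (covers y v)) => [/andP[vy _]|]; last by rewrite !muln0 mul0n.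
  suff -> : ((aval z + aval v) :&: h == 0)%VS by rewrite muln1.
  by apply: disjointS (attP y); rewrite subv_add zy.
have -> : (\sum_(v : X | v != z)
     covers v w * covers y v * ((aval z + aval v) :&: h == 0)%VS =
   \sum_(v : X)
     covers v w * covers y v * ((aval z + aval v) :&: h == 0)%VS)%N.
  rewrite [RHS](bigD1 z) //=.
  have -> : covers y z = false by rewrite /vcover (negPf zy).
  by rewrite muln0 mul0n add0n.
case: (boolP (_ == 0)%VS) => [hzy|nzy].
  rewrite addn1 -tot; apply: eq_bigr => v _.
  case: (boolP (covers y v)) => [/andP[vy _]|]; last by rewrite !muln0 mul0n.
  suff -> : ((aval z + aval v) :&: h == 0)%VS by rewrite muln1.
  by apply: disjointS hzy; rewrite addvS.
have one := sum_not_disjoint cw wy zy dy nzy.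
rewrite addn0; apply: (@addIn 1).
rewrite [RHS]addn1 -tot -[X in (_ + X)%N = _]one -big_split /=.
apply: eq_bigr => v _.
by case: (_ == 0)%VS; rewrite /= ?andbT ?andbF ?muln1 ?muln0 ?addn0 ?add0n ?mulnb.
Qed.

(* For [v != z] on a path z < u > v < y, the top is [z + v], and [w = z :&: v] *)
(* is covered by both [z] and [v]: this replaces the choice of [u] by that of  *)
(* a [w] covered by [z].                                                       *)
Lemma path_up_down_up z y : \dim (aval y) = (\dim (aval z)).+1 ->
  (\sum_(v : X) \sum_(u : X) covers u z * covers u v * covers y v
   = (aval z <= aval y)%VS * upnum z + (q + joinable z y) * common_down z y)%N.
Proof.
move=> dy; rewrite (bigD1 z) //=; congr (_ + _)%N.
  have -> : covers y z = (aval z <= aval y)%VS by rewrite /vcover dy eqxx andbT.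
  rewrite -big_distrl /= mulnC; congr (_ * _)%N.
  rewrite /upnum -sum1dep_card [RHS]big_mkcond /=; apply: eq_bigr => u _.
  by case: (covers u z).
transitivity (\sum_(v : X | v != z) \sum_(w : X) covers z w *
   (covers v w * covers y v * ((aval z + aval v) :&: h == 0)%VS))%N.
  apply: eq_bigr => v vz; rewrite -big_distrl /=.
  case: (boolP (covers y v)) => [/andP[_ /eqP dyv]|]; last first.
    by rewrite muln0 big1 // => w _; rewrite muln0 mul0n muln0.
  rewrite muln1 sum_up_down 1?eq_sym //; last by lia.
  rewrite big_distrr /=; apply: eq_bigr => w _.
  by rewrite muln1 mulnCA [(_ * covers v w)%N]mulnC.
rewrite exchange_big /common_down big_distrr /=; apply: eq_bigr => w _.
rewrite -big_distrr /=; case: (boolP (covers z w)) => [cw|]; last by rewrite muln0.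
by rewrite sum_between_disjoint // mul1n mulnC.
Qed.

End Paths.

(** * The cubic relation *)

Section Cubic.
Variables (F : finFieldType) (H : vectType F) (h : {vspace H}).
Local Notation q := #|F|.
Local Notation X := (attSpace h).
Implicit Types u v w y z : X.
Local Notation covers u z := (vcover (aval u) (aval z)).

(** With m = dim z and D = dim H, [upnum z] equals (q^(D - m) - q^(dim h)) / (q - 1), so its
    decrease is q^(D - m - 1). The term in h cancels, which makes the linear coefficient of the
    cubic relation the same at every rank. *)
Lemma upnum_step z y :
  (aval z <= aval y)%VS -> \dim (aval y) = (\dim (aval z)).+1 ->
  (upnum z * q ^ (\dim (aval z)).+1
   = upnum y * q ^ (\dim (aval z)).+1 + q ^ \dim {:H})%N.
Proof.
move=> zy dy; have := upnum_mul z; have := upnum_mul y; rewrite dy.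
have : (\dim (aval y) + \dim h <= \dim {:H})%N.
  by rewrite -(dimv_disjoint_sum (eqP (attP y))) dimvS ?subvf.
rewrite dy; set m := \dim (aval z); set D := \dim {:H} => le.
have le1 : (q ^ (m.+1 + \dim h) <= q ^ D)%N.
  by rewrite leq_pexp2l // ltnW // card_field_gt1.
have le2 : (q ^ (m + \dim h) <= q ^ D)%N.
  rewrite leq_pexp2l ?(ltnW (card_field_gt1 _)) //.
  by rewrite (leq_trans _ le) // leq_add2r.
move: le1 le2; rewrite !expnD !expnS; have := card_field_gt1 F.
case: q => // -[//|p] _; set a := (_ ^ m)%N; set b := (_ ^ \dim h)%N; set e := (_ ^ D)%N.
move: (upnum z) (upnum y) => U V le1 le2 eV eU.
(* [p.+1] is q - 1, the denominator of both cover counts. *)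
suff : (p.+1 * (U * (p.+2 * a)) = p.+1 * (V * (p.+2 * a) + e))%N.
  by move/eqP; rewrite eqn_pmul2l // => /eqP.
nia.
Qed.

Variable C : numFieldType.
Local Notation n := #|{: X}|.
Local Notation qC := (q%:R : C).

Definition raising_mx : 'M[C]_n :=
  \matrix_(i, j) (covers (enum_val i) (enum_val j))%:R.

Definition lowering_mx : 'M[C]_n :=
  \matrix_(i, j)
    ((covers (enum_val j) (enum_val i))%:R * qC ^+ \dim (aval (enum_val i))).

Lemma att_mx_split : att_mx h C = raising_mx + lowering_mx.
Proof.
apply/matrixP => i j; rewrite !mxE /= !coversE.
case: (boolP (covers _ _)) => [/andP[_ /eqP d1]|_];
  case: (boolP (covers _ _)) => [/andP[_ /eqP d2]|_].
- by exfalso; lia.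
- by rewrite mul0r addr0.
- by rewrite add0r mul1r.
- by rewrite mul0r addr0.
Qed.

Lemma qC_neq0 : qC != 0.
Proof. by rewrite pnatr_eq0 -lt0n ltnW // card_field_gt1. Qed.

Lemma att_dual_mxE i j :
  att_dual_mx h C i j = (i == j)%:R * (qC ^+ \dim (aval (enum_val i)))^-1.
Proof. by rewrite mxE; case: eqP => _; rewrite ?mul1r ?mul0r. Qed.

Lemma att_dual_mulE p (B : 'M[C]_(n, p)) i j :
  (att_dual_mx h C *m B) i j = (qC ^+ \dim (aval (enum_val i)))^-1 * B i j.
Proof.
rewrite mxE (bigD1 i) //= big1 ?addr0 => [|k ki]; rewrite att_dual_mxE.
  by rewrite eqxx mul1r.
by rewrite eq_sym (negPf ki) !mul0r.
Qed.

Lemma mul_att_dualE (B : 'M[C]_n) i j :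
  (B *m att_dual_mx h C) i j = B i j * (qC ^+ \dim (aval (enum_val j)))^-1.
Proof.
rewrite mxE (bigD1 j) //= big1 ?addr0 => [|k kj]; rewrite att_dual_mxE.
  by rewrite eqxx mul1r.
by rewrite (negPf kj) mul0r mulr0.
Qed.

Lemma dual_raising :
  att_dual_mx h C *m raising_mx = qC^-1 *: (raising_mx *m att_dual_mx h C).
Proof.
apply/matrixP => i j; rewrite [RHS]mxE att_dual_mulE mul_att_dualE !mxE.
case: (boolP (covers _ _)) => [/andP[_ /eqP ->]|_]; last by rewrite mul0r !mulr0.
by rewrite exprS invfM mul1r mulr1.
Qed.

Lemma dual_lowering :
  att_dual_mx h C *m lowering_mx = qC *: (lowering_mx *m att_dual_mx h C).
Proof.
apply/matrixP => i j; rewrite [RHS]mxE att_dual_mulE mul_att_dualE !mxE.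
case: (boolP (covers _ _)) => [/andP[_ /eqP ->]|_]; last by rewrite !mul0r !mulr0.
have q0 := qC_neq0; have e0 := expf_neq0 (\dim (aval (enum_val i))) q0.
by rewrite exprS invfM mul1r mulVf // mulrCA mulVKf // mulfV.
Qed.

Lemma mulmx3E (B1 B2 B3 : 'M[C]_n) i j :
  (B1 *m B2 *m B3) i j =
  \sum_(v : X) \sum_(u : X) B1 i (enum_rank v) * B2 (enum_rank v) (enum_rank u)
     * B3 (enum_rank u) j.
Proof.
have rkK : {on [pred _ | true], bijective (@enum_rank X)}.
  by exists enum_val => ? _; rewrite ?enum_rankK ?enum_valK.
rewrite -mulmxA mxE (reindex enum_rank) //=; apply: eq_bigr => v _.
rewrite mxE big_distrr /= (reindex enum_rank) //=.
by apply: eq_bigr => u _; rewrite mulrA.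
Qed.

(** The entry at (y, z) vanishes unless dim y = dim z + 1; then it weighs the three path counts. The
    contributions of [common_down] without [joinable] cancel between R L R and R R L, those with
    [joinable] match L R R, and [upnum_step] accounts for the last term. *)
Lemma lowering_raising_cubic :
  lowering_mx *m raising_mx *m raising_mx =
  (qC * (qC + 1)) *: (raising_mx *m lowering_mx *m raising_mx)
  - qC ^+ 3 *: (raising_mx *m raising_mx *m lowering_mx)
  - ((qC + 1) * qC ^+ \dim {:H}) *: raising_mx.
Proof.
apply/matrixP => i j.
have sw1 (a b c d : C) : b * a * c * d = a * (d * c * b) by ring.
have sw2 (a b c d : C) : b * (c * a) * d = a * (d * c * b) by ring.
have sw3 (x a b c d : C) : x * (b * c * (d * a)) = x * a * (d * c * b) by ring.
have subE (B1 B2 : 'M[C]_n) : (B1 - B2) i j = B1 i j - B2 i j by rewrite !mxE.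
have scaleE a (B : 'M[C]_n) : (a *: B) i j = a * B i j by rewrite mxE.
rewrite !subE !scaleE !mulmx3E [raising_mx i j]mxE.
have -> : \sum_(v : X) \sum_(u : X) lowering_mx i (enum_rank v)
      * raising_mx (enum_rank v) (enum_rank u) * raising_mx (enum_rank u) j =
    qC ^+ \dim (aval (enum_val i)) * (\sum_(v : X) \sum_(u : X) 
      covers u (enum_val j) * covers v u * covers v (enum_val i))%N%:R.
  rewrite natr_sum big_distrr; apply: eq_bigr => v _; rewrite natr_sum big_distrr.
  apply: eq_bigr => u _ /=; rewrite !mxE !enum_rankK !natrM.
  exact: sw1.
have -> : \sum_(v : X) \sum_(u : X) raising_mx i (enum_rank v)
      * lowering_mx (enum_rank v) (enum_rank u) * raising_mx (enum_rank u) j =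
    qC ^+ \dim (aval (enum_val j)) * (\sum_(v : X) \sum_(u : X) 
      covers u (enum_val j) * covers u v * covers (enum_val i) v)%N%:R.
  rewrite natr_sum big_distrr; apply: eq_bigr => v _; rewrite natr_sum big_distrr.
  apply: eq_bigr => u _ /=; rewrite !mxE !enum_rankK !natrM.
  case: (boolP (covers u (enum_val j))) => [/andP[_ /eqP d1]|]; last first.
    by rewrite !mul0r !mulr0.
  case: (boolP (covers u v)) => [/andP[_ /eqP d2]|]; last first.
    by rewrite !(mul0r, mulr0).
  have -> : \dim (aval v) = \dim (aval (enum_val j)) by lia.
  exact: sw2.
(* Here L ends one rank below z, so its weight becomes a power of exponent dim z only after a
   multiplication by q. *)
have E3 : qC * \sum_(v : X) \sum_(u : X) raising_mx i (enum_rank v)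
      * raising_mx (enum_rank v) (enum_rank u) * lowering_mx (enum_rank u) j =
    qC ^+ \dim (aval (enum_val j)) * (\sum_(v : X) \sum_(u : X) 
      covers (enum_val j) u * covers v u * covers (enum_val i) v)%N%:R.
  rewrite natr_sum !big_distrr; apply: eq_bigr => v _; rewrite natr_sum !big_distrr.
  apply: eq_bigr => u _ /=; rewrite !mxE !enum_rankK !natrM.
  case: (boolP (covers (enum_val j) u)) => [/andP[_ /eqP ->]|]; last first.
    by rewrite !(mul0r, mulr0).
  by rewrite exprS; exact: sw3.
have -> : qC ^+ 3 = qC ^+ 2 * qC by rewrite exprSr.
rewrite -[_ * qC * _]mulrA E3.
move: (enum_val i) (enum_val j) => y z {subE scaleE E3 i j}.
case: (eqVneq (\dim (aval y)) (\dim (aval z)).+1) => [dy|ndy]; last first.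
  have -> : covers y z = false by apply/negP => /andP[_]; apply/negP.
  rewrite !big1 ?mulr0 ?subr0 // => v _; apply: big1 => u _; apply/eqP;
    rewrite !muln_eq0 !eqb0 -!negb_and; apply/negP;
    move=> /andP[/andP[/andP[_ /eqP d1] /andP[_ /eqP d2]] /andP[_ /eqP d3]];
    move/eqP: ndy; lia.
rewrite path_up_up_down // path_up_down_up // path_down_up_up // /vcover dy eqxx andbT.
rewrite !(natrM, natrD) -natr1 exprS.
case: (boolP (aval z <= aval y)%VS) => zy; last first.
  move: qC (qC ^+ \dim (aval z)) (qC ^+ \dim {:H})
    (joinable z y)%:R (common_down z y)%:R.
  by move=> a b c J S; rewrite !mul0r !add0r mulr0; ring.
have := congr1 (fun k : nat => k%:R : C) (upnum_step zy dy).
rewrite !(natrM, natrD, natrX) exprS !mul1r mulr1.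
move: qC (qC ^+ \dim (aval z)) (qC ^+ \dim {:H}) (upnum z)%:R (upnum y)%:R
  (joinable z y)%:R (common_down z y)%:R => a b c Uz Uy J S st.
transitivity ((a + 1) * (Uy * (a * b) + a * b * J * S)); first by ring.
have -> : Uy * (a * b) = Uz * (a * b) - c by rewrite st addrK.
by ring.
Qed.
End Cubic.

(** * Leonard pairs of dual q-Krawtchouk type *)

Section LeonardCriterion.
Variables (K : fieldType) (U : vectType K).

(** Applying the product of all f - t j with j != i to a linear relation isolates its i-th term. *)
Lemma free_eigenvectors n (f : 'End(U)) (v : 'I_n -> U) (t : 'I_n -> K) :
  injective t -> (forall i, v i != 0) -> (forall i, f (v i) = t i *: v i) ->
  free [tuple v i | i < n].
Proof.
move=> tI v0 fv; apply/freeP => c.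
under eq_bigr => i _ do rewrite (nth_map i) ?size_enum_ord // nth_ord_enum.
move=> c0 i.
have kill (rs : seq K) : \sum_j (c j * \prod_(r <- rs) (t j - r)) *: v j = 0.
  elim: rs => [|r rs IH].
    by rewrite -[RHS]c0; apply: eq_bigr => j _; rewrite big_nil mulr1.
  have := congr1 (fun x => f x - r *: x) IH.
  rewrite linear0 scaler0 subr0 linear_sum scaler_sumr -sumrB => {2}<-.
  apply: eq_bigr => j _; rewrite linearZ /= fv big_cons !scalerA -scalerBl.
  by congr (_ *: _); ring.
have := kill [seq t j | j <- enum 'I_n & j != i].
rewrite (bigD1 i) //= [X in _ + X]big1 ?addr0 => [|j ji]; last first.
  rewrite big_map big_filter (big_rem j) ?mem_enum //= ji subrr mul0r mulr0.
  by rewrite scale0r.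
move/eqP; rewrite scaler_eq0 (negPf (v0 i)) orbF mulf_eq0 => /orP[/eqP //|].
rewrite prodf_seq_eq0 => /hasP[x /mapP[j]].
rewrite mem_filter => /andP[ji _] -> /=.
by rewrite subr_eq0 => /eqP /tI ij; rewrite ij eqxx in ji.
Qed.

Variables (w : nat -> U) (ka : nat -> K) (f fs : 'End(U)).
Local Notation n := (\dim {:U}).
Hypothesis ka_inj : forall i j, (i < n)%N -> (j < n)%N -> ka i = ka j -> i = j.
Hypothesis w_neq0 : forall j, (j < n)%N -> w j != 0.
Hypothesis fs_w : forall j, (j < n)%N -> fs (w j) = ka j *: w j.

Let e : n.-tuple U := [tuple w i | i < n].

Let nth_e (i : 'I_n) : e`_i = w i.
Proof. by rewrite (nth_map i) ?size_enum_ord // nth_ord_enum. Qed.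

Let free_e : free e.
Proof.
apply: (@free_eigenvectors n fs (fun i => w i) (fun i => ka i)).
- by move=> i j /ka_inj ij; apply: val_inj; apply: ij.
- by move=> i; apply: w_neq0.
- by move=> i; apply: fs_w.
Qed.

Let basis_e : basis_of {:U} e.
Proof. by rewrite basisEfree free_e subvf size_tuple leqnn. Qed.

Let coord_e (i : 'I_n) j : (j < n)%N -> coord e i (w j) = (i == j :> nat)%:R.
Proof.
move=> jn; have -> : w j = e`_(Ordinal jn) by rewrite nth_e.
by rewrite coord_free // eq_sym -val_eqE.
Qed.

Lemma free_eigen_sum (c : nat -> K) :
  \sum_(i < n) c i *: w i = 0 -> forall i, (i < n)%N -> c i = 0.
Proof.
move=> c0 i lt_in; have /freeP fr := free_e.
apply: (fr (fun i => c i) _ (Ordinal lt_in)); rewrite -[RHS]c0.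
by apply: eq_bigr => j _; rewrite nth_e.
Qed.

(** Serves for both halves of a Leonard pair. The vanishing of [up] at the top and of [down] at 0
    cancels the out-of-range [w j.+1] and the spurious [w 0.-1], which is [w 0]. *)
Lemma eigenbasis_irred_tridiagonal (up mid down : nat -> K) :
  (forall j, (j < n)%N ->
     f (w j) = up j *: w j.+1 + mid j *: w j + down j *: w j.-1) ->
  (forall j, (j.+1 < n)%N -> up j != 0) -> up n.-1 = 0 ->
  (forall j, (0 < j < n)%N -> down j != 0) -> down 0%N = 0 ->
  exists e : n.-tuple U,
    [/\ basis_of {:U} e, irred_tridiagonal (repr_mx e f)
      & is_diag_mx (repr_mx e fs)].
Proof.
move=> fw up0 upn down_neq0 down0; exists e.
have fE (i j : 'I_n) : repr_mx e f i j =
  up j * (i == j.+1 :> nat)%:R + mid j * (i == j :> nat)%:R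
  + down j * (i.+1 == j :> nat)%:R.
  rewrite mxE nth_e fw // !linearD !linearZ /=.
  congr (_ + _ + _); last first.
  - case: (nat_of_ord j) (ltn_ord j) => [|j'] jn; first by rewrite down0 !mul0r.
    by rewrite coord_e ?eqSS // ltnW.
  - by rewrite coord_e.
  case: (ltnP j.+1 n) => jn; first by rewrite coord_e.
  have -> : nat_of_ord j = n.-1 by have := ltn_ord j; lia.
  by rewrite upn !mul0r.
split => //.
- split=> [i j|i j ij].
    rewrite fE; case: (eqVneq (i : nat) j.+1) => [ij _|_]; first by constructor 2.
    case: (eqVneq (i : nat) j) => [ij _|_]; first by constructor 1.
    case: (eqVneq i.+1 (j : nat)) => [ij _|_]; first by constructor 3.
    by rewrite !mulr0 !addr0 eqxx.
  rewrite fE; case: ij => ij; rewrite ij.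
    have [-> ->] : (j.+1 == j) = false /\ (j.+2 == j) = false by lia.
    rewrite eqxx !mulr0 !addr0 mulr1; apply: up0; rewrite -ij; exact: ltn_ord.
  have [-> ->] : (i == i.+2 :> nat) = false /\ (i == i.+1 :> nat) = false by lia.
  by rewrite eqxx !mulr0 !add0r mulr1; apply: down_neq0; rewrite -{2}ij ltn_ord.
- apply/is_diag_mxP => i j ij; rewrite mxE nth_e fs_w // linearZ /= coord_e //.
  by rewrite (negPf ij) mulr0.
Qed.

End LeonardCriterion.

(** * The polynomial model of dual q-Krawtchouk type *)

Section DualKrawtchouk.
Variables (C : numFieldType) (q : C).
Hypothesis q_gt1 : 1 < q.

Let q_gt0 : 0 < q. Proof. exact: lt_trans ltr01 q_gt1. Qed.
Let q_neq0 : q != 0. Proof. exact: lt0r_neq0. Qed.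

(** The q-shifted factorial (-c t; q)_m, with t = ['X]. *)
Definition qfact (c : C) (m : nat) : {poly C} :=
  \prod_(i < m) (1 + (c * q ^+ i)%:P * 'X).

Lemma qfactS c m : qfact c m.+1 = qfact c m * (1 + (c * q ^+ m)%:P * 'X).
Proof. by rewrite /qfact big_ord_recr. Qed.

Lemma qfact_scale c m :
  (qfact c m \Po (q%:P * 'X)) * (1 + c%:P * 'X) = qfact c m.+1.
Proof.
rewrite /qfact big_ord_recl expr0 mulr1 mulrC rmorph_prod /=; congr (_ * _).
apply: eq_bigr => i _; rewrite rmorphD rmorph1 rmorphM /= comp_polyC comp_polyX.
by rewrite mulrA -polyCM exprS; congr (_ + _%:P * _); ring.
Qed.

Lemma qfact_scaleV c m :
  (qfact c m \Po (q^-1%:P * 'X)) * (1 + (c * q ^+ m / q)%:P * 'X)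
  = (1 + (c / q)%:P * 'X) * qfact c m.
Proof.
have := congr1 (fun p => p \Po (q^-1%:P * 'X)) (qfact_scale c m).
rewrite qfactS !rmorphM !rmorphD !rmorph1 /= !comp_polyM !comp_polyC !comp_polyX.
rewrite -comp_polyA comp_polyM comp_polyC comp_polyX !mulrA -!polyCM mulfV //.
rewrite polyC1 mul1r comp_polyXr.
by move=> <-; rewrite mulrC.
Qed.

Lemma coef_comp_scale (p : {poly C}) a j : (p \Po (a%:P * 'X))`_j = a ^+ j * p`_j.
Proof.
elim/poly_ind: p j => [|p c IH] j; first by rewrite comp_poly0 coef0 mulr0.
rewrite comp_polyD comp_polyM comp_polyX comp_polyC !coefD !coefC mulrA !coefMX.
rewrite [_ * a%:P]mulrC coefCM; case: j => [|j] /=; first by rewrite expr0 mul1r.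
by rewrite IH !addr0 exprS mulrA.
Qed.

Lemma size_qfact c m : (size (qfact c m) <= m.+1)%N.
Proof.
elim: m => [|m IH]; first by rewrite /qfact big_ord0 size_poly1.
rewrite qfactS (leq_trans (size_polyMleq _ _)) //.
have : (size (1 + (c * q ^+ m)%:P * 'X)%R <= 2)%N.
  rewrite (leq_trans (size_polyD _ _)) // geq_max size_poly1 /=.
  rewrite (leq_trans (size_polyMleq _ _)) // size_polyX.
  by have := size_polyC_leq1 (c * q ^+ m); lia.
lia.
Qed.

Lemma coef0_qfact c m : (qfact c m)`_0 = 1.
Proof.
elim: m => [|m IH]; first by rewrite /qfact big_ord0 coef1.
by rewrite qfactS coef0M IH coefD coef1 coefCM coefX mulr0 addr0 mulr1.
Qed.

Variable d : nat.

(* The solution of [(1 - t^2) f(qt) = (1 + q^(d-k) t) (1 - q^k t) f(t)].       *)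
Definition krawp k := qfact 1 (d - k) * qfact (-1) k.

Lemma krawp0 k : (krawp k)`_0 = 1.
Proof. by rewrite coef0M !coef0_qfact mulr1. Qed.

Lemma size_krawp k : (k <= d)%N -> (size (krawp k) <= d.+1)%N.
Proof.
move=> kd; rewrite (leq_trans (size_polyMleq _ _)) //.
have := size_qfact 1 (d - k); have := size_qfact (-1) k; lia.
Qed.

Lemma krawp_scale k :
  (krawp k \Po (q%:P * 'X)) * (1 - 'X^2) =
  krawp k * ((1 + (q ^+ (d - k))%:P * 'X) * (1 - (q ^+ k)%:P * 'X)).
Proof.
have e1 := qfact_scale 1 (d - k); have e2 := qfact_scale (-1) k.
rewrite /krawp comp_polyM.
have -> : 1 - 'X^2 = (1 + 1%:P * 'X) * (1 + (-1)%:P * 'X) :> {poly C}.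
  by rewrite polyCN polyC1; ring.
by rewrite mulrACA e1 e2 !qfactS mul1r mulN1r polyCN; ring.
Qed.

(* The coefficient of [t^(j+1)] in [krawp_scale]; for [j = 0] there is no      *)
(* coefficient of index [j - 1].                                               *)
Lemma krawp_coef k j : (k <= d)%N ->
  (q ^+ j.+1 - 1) * (krawp k)`_j.+1
  + (if j is j'.+1 then (q ^+ d - q ^+ j') * (krawp k)`_j' else 0)
  = (q ^+ (d - k) - q ^+ k) * (krawp k)`_j.
Proof.
move=> kd; set p := krawp k; set a := q ^+ (d - k) - q ^+ k.
have : (p \Po (q%:P * 'X)) - (p \Po (q%:P * 'X)) * 'X^2 =
   p + (a%:P * p) * 'X - ((q ^+ d)%:P * p) * 'X^2.
  have -> : q ^+ d = q ^+ (d - k) * q ^+ k by rewrite -exprD subnK.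
  transitivity ((p \Po (q%:P * 'X)) * (1 - 'X^2)); first by rewrite mulrBr mulr1.
  by rewrite krawp_scale -/p /a polyCB polyCM; ring.
move/(congr1 (fun r : {poly C} => r`_j.+1)).
rewrite !(coefB, coefD, coefMXn, coefMX, coefCM, coef_comp_scale) /=.
case: j => [|j] /=.
  by rewrite subr0 => e; rewrite addr0 mulrBl mul1r e; ring.
have -> : (j.+2 - 2 = j)%N by rewrite -addn2 addnK.
move: (p`_j) (p`_j.+1) (p`_j.+2) (q ^+ j) (q ^+ j.+2) (q ^+ d) => r0 r1 r2 x y z e.
have -> : a * r1 = y * r2 - x * r0 - r2 + z * r0 by rewrite e; ring.
by ring.
Qed.

Lemma krawp_scaleV k :
  (krawp k \Po (q^-1%:P * 'X)) *
    ((1 + (q ^+ (d - k) / q)%:P * 'X) * (1 - (q ^+ k / q)%:P * 'X))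
  = (1 - (q ^- 2)%:P * 'X^2) * krawp k.
Proof.
have e1 := qfact_scaleV 1 (d - k); have e2 := qfact_scaleV (-1) k.
rewrite /krawp comp_polyM.
have -> : 1 - (q ^- 2)%:P * 'X^2 =
   (1 + (1 / q)%:P * 'X) * (1 + (-1 / q)%:P * 'X) :> {poly C}.
  by rewrite mulNr polyCN mul1r -exprVn polyCM; ring.
rewrite -[RHS]mulrACA -e1 -e2 mul1r mulN1r mulNr polyCN; ring.
Qed.

(* The coefficients come from evaluating the three-term relation, divided by   *)
(* the common factor of its terms, at the two roots of the outer quadratics.   *)
Definition krawp_up k : C :=
  (q ^+ (d - k) ^+ 2 - 1) /
  ((q ^+ (d - k) + q ^+ k) * (q ^+ (d - k) + q * q ^+ k)).

Definition krawp_down k : C :=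
  (q ^+ k ^+ 2 - 1) / ((q ^+ (d - k) + q ^+ k) * (q ^+ k + q * q ^+ (d - k))).

(** Forced by constant terms: every [krawp k] takes the value 1 at 0. *)
Definition krawp_mid k : C := 1 - krawp_up k - krawp_down k.

(** Neighbouring [krawp] differ by one linear factor in each of their two products. After
    multiplication by [den] every term is a multiple of [krawp k], and what remains is an identity
    of quadratic polynomials, given by [e0], [e1], [e2] in degrees 0, 1, 2. *)
Lemma krawp_three_term k : (k <= d)%N ->
  krawp k \Po (q^-1%:P * 'X) =
  (krawp_up k)%:P * krawp k.+1 + (krawp_mid k)%:P * krawp k
  + (krawp_down k)%:P * krawp k.-1.
Proof.
move=> kd; set a := q ^+ (d - k); set b := q ^+ k.
have a0 : 0 < a by apply: exprn_gt0.
have b0 : 0 < b by apply: exprn_gt0.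
set den := (1 + (a / q)%:P * 'X) * (1 - (b / q)%:P * 'X) : {poly C}.
have den0 : den != 0.
  apply/eqP => /(congr1 (fun p : {poly C} => p`_0)).
  rewrite coef0M coefD coefB !coefCM coefX !mulr0 coef1 coef0 addr0 subr0 mulr1.
  by apply/eqP; rewrite oner_neq0.
apply: (mulIf den0); rewrite krawp_scaleV.
have upE : (krawp_up k)%:P * krawp k.+1 * (1 + (a / q)%:P * 'X) =
   (krawp_up k)%:P * krawp k * (1 - b%:P * 'X).
  (* At k = d the truncated [d - k.+1] would break the factor relation, but [krawp_up d] is 0. *)
  case: (eqVneq k d) => [->|nkd].
    by rewrite /krawp_up subnn expr0 expr1n subrr mul0r polyC0 !mul0r.
  have dk : (d - k = (d - k.+1).+1)%N by have := kd; lia.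
  rewrite /krawp dk !qfactS mul1r mulN1r polyCN /a dk exprSr mulfK //.
  by rewrite -/b; ring.
have downE : (krawp_down k)%:P * krawp k.-1 * (1 - (b / q)%:P * 'X) =
   (krawp_down k)%:P * krawp k * (1 + a%:P * 'X).
  rewrite /a /b; case: k kd {a b a0 b0 den den0 upE} => [|k] kd.
    by rewrite /krawp_down expr0 expr1n subrr mul0r polyC0 !mul0r.
  have dk : (d - k = (d - k.+1).+1)%N by have := kd; lia.
  rewrite /krawp /= dk !qfactS mul1r mulN1r polyCN exprSr mulfK //.
  by ring.
have -> : ((krawp_up k)%:P * krawp k.+1 + (krawp_mid k)%:P * krawp k
   + (krawp_down k)%:P * krawp k.-1) * den =
   krawp k * ((krawp_up k)%:P * (1 - b%:P * 'X) * (1 - (b / q)%:P * 'X)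
     + (krawp_mid k)%:P * den
     + (krawp_down k)%:P * (1 + a%:P * 'X) * (1 + (a / q)%:P * 'X)).
  transitivity (
    (krawp_up k)%:P * krawp k.+1 * (1 + (a / q)%:P * 'X) * (1 - (b / q)%:P * 'X)
    + krawp k * ((krawp_mid k)%:P * den)
    + (krawp_down k)%:P * krawp k.-1 * (1 - (b / q)%:P * 'X)
      * (1 + (a / q)%:P * 'X)).
    by rewrite /den; ring.
  by rewrite upE downE; ring.
rewrite [LHS]mulrC; congr (_ * _); rewrite /den.
have e1 : krawp_mid k * ((a - b) / q) =
    krawp_up k * (b + b / q) - krawp_down k * (a + a / q).
  rewrite /krawp_mid /krawp_up /krawp_down -/a -/b; field.
  by rewrite !lt0r_neq0 ?addr_gt0 ?mulr_gt0.
have e2 : krawp_up k * (b * b / q) - krawp_mid k * (a * b / q ^+ 2)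
    + krawp_down k * (a * a / q) = - q ^- 2.
  rewrite /krawp_mid /krawp_up /krawp_down -/a -/b; field.
  by rewrite !lt0r_neq0 ?addr_gt0 ?mulr_gt0.
have e0 : 1 = krawp_up k + krawp_mid k + krawp_down k by rewrite /krawp_mid; ring.
move: (krawp_up k) (krawp_mid k) (krawp_down k) e0 e1 e2 => x y z e0 e1 e2.
transitivity ((x + y + z)%:P
   + (y * ((a - b) / q) - (x * (b + b / q) - z * (a + a / q)))%:P * 'X
   + (x * (b * b / q) - y * (a * b / q ^+ 2) + z * (a * a / q))%:P * 'X^2).
  by rewrite e1 subrr e2 -e0 polyC0 polyC1 mul0r addr0 polyCN mulNr.
rewrite -[q ^- 2]exprVn !(polyCD, polyCB, polyCM, polyCN).
by move: (_%:P) (_%:P) (_%:P) (_%:P) (_%:P) (_%:P) => *; ring.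
Qed.

Let pow_inj i j : q ^+ i = q ^+ j -> i = j.
Proof. by apply: ieexprIn; rewrite // gt_eqF. Qed.

Section Action.
Variables (U : vectType C) (B Bs : 'End(U)) (b : nat -> U) (s rho : C).
Hypothesis s_neq0 : s != 0.
Hypothesis rho_neq0 : rho != 0.
Hypothesis dimU : \dim {:U} = d.+1.
Hypothesis b_neq0 : forall j, (j <= d)%N -> b j != 0.
Hypothesis Bs_b : forall j, (j <= d)%N -> Bs (b j) = (rho * q ^- j) *: b j.
Hypothesis B_b : forall j, (j <= d)%N ->
  B (b j) = (s * (q ^+ d - q ^+ j)) *: b j.+1 + (s * (q ^+ j - 1)) *: b j.-1.

Let dual_eig_inj i j : rho * q ^- i = rho * q ^- j -> i = j.
Proof. by move/(mulfI rho_neq0)/invr_inj/pow_inj. Qed.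

(** The image of [krawp k] when t^j is identified with [b j]. Under this identification [Bs] is
    [rho] times the substitution of t / q for t, and [B f] is [s] times t (q^d f(t) - f(q t)) + (f(q
    t) - f(t)) / t. *)
Definition krawvec k : U := \sum_(j < d.+1) (krawp k)`_j *: b j.

Lemma krawvec_neq0 k : krawvec k != 0.
Proof.
apply/eqP; rewrite /krawvec -dimU.
move/(free_eigen_sum (fs := Bs) (ka := fun j => rho * q ^- j)) => e0.
have := e0 _ _ _ 0%N; rewrite krawp0 dimU => e1.
suff : 1 = 0 :> C by apply/eqP; rewrite oner_neq0.
apply: e1 => // i j _ _; exact: dual_eig_inj.
Qed.

Lemma B_krawvec k : (k <= d)%N ->
  B (krawvec k) = (s * (q ^+ (d - k) - q ^+ k)) *: krawvec k.
Proof.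
move=> kd; rewrite /krawvec linear_sum scaler_sumr.
have -> : \sum_(j < d.+1) B ((krawp k)`_j *: b j) =
  \sum_(j < d.+1) ((krawp k)`_j * (s * (q ^+ d - q ^+ j))) *: b j.+1
  + \sum_(j < d.+1) ((krawp k)`_j * (s * (q ^+ j - 1))) *: b j.-1.
  rewrite -big_split; apply: eq_bigr => j _ /=.
  by rewrite linearZ /= B_b ?scalerDr ?scalerA // -ltnS.
have -> : \sum_(j < d.+1) ((krawp k)`_j * (s * (q ^+ d - q ^+ j))) *: b j.+1 =
   \sum_(j < d.+1)
     (if nat_of_ord j is j'.+1
      then (krawp k)`_j' * (s * (q ^+ d - q ^+ j')) else 0) *: b j.
  rewrite big_ord_recr big_ord_recl /= subrr !mulr0 !scale0r addr0 add0r.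
  by apply: eq_bigr.
have -> : \sum_(j < d.+1) ((krawp k)`_j * (s * (q ^+ j - 1))) *: b j.-1 =
   \sum_(j < d.+1) ((krawp k)`_j.+1 * (s * (q ^+ j.+1 - 1))) *: b j.
  rewrite big_ord_recl big_ord_recr /= expr0 subrr !mulr0 !scale0r add0r.
  (* The shifted sum reaches the coefficient of index d + 1, beyond the degree. *)
  rewrite nth_default ?size_krawp // mul0r scale0r addr0.
  by apply: eq_bigr.
rewrite -big_split; apply: eq_bigr => j _ /=; rewrite -scalerDl scalerA.
congr (_ *: _); rewrite -mulrA -krawp_coef //.
by case: (nat_of_ord j) => [|j']; rewrite ?add0r ?addr0; ring.
Qed.

Lemma Bs_krawvec k : (k <= d)%N ->
  Bs (krawvec k) = (rho * krawp_up k) *: krawvec k.+1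
    + (rho * krawp_mid k) *: krawvec k + (rho * krawp_down k) *: krawvec k.-1.
Proof.
move=> kd; rewrite /krawvec linear_sum !scaler_sumr -!big_split.
apply: eq_bigr => j _ /=; rewrite linearZ /= Bs_b -1?ltnS // !scalerA -!scalerDl.
congr (_ *: _); rewrite -!mulrA -!mulrDr mulrCA; congr (_ * _).
rewrite -exprVn mulrC -coef_comp_scale krawp_three_term //.
by rewrite !coefD !coefCM /krawp_up /krawp_down !mulrA.
Qed.

Lemma dual_krawtchouk_leonard_pair : leonard_pair B Bs.
Proof.
split; first by rewrite dimU.
  apply: (@eigenbasis_irred_tridiagonal _ _ b (fun j => rho * q ^- j) B Bs _ _ _
    (fun j => s * (q ^+ d - q ^+ j)) (fun=> 0) (fun j => s * (q ^+ j - 1)));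
  rewrite ?dimU ?subrr ?mulr0 //.
  - by move=> i j _ _; apply: dual_eig_inj.
  - by move=> j jd; rewrite scale0r addr0 B_b.
  - move=> j jd; rewrite mulf_neq0 // subr_eq0; apply/eqP => /pow_inj; lia.
  - move=> j /andP[j0 jd]; rewrite mulf_neq0 // subr_eq0 -(expr0 q).
    by apply/eqP => /pow_inj; lia.
have qp k : 0 < q ^+ k by rewrite exprn_gt0.
apply: (@eigenbasis_irred_tridiagonal _ _ krawvec
    (fun k => s * (q ^+ (d - k) - q ^+ k)) Bs B _ _ _ (fun k => rho * krawp_up k)
    (fun k => rho * krawp_mid k) (fun k => rho * krawp_down k));
  rewrite ?dimU.
(* The eigenvalues are distinct because q^(d - i) - q^i strictly decreases in i. *)
- move=> i j id jd /(mulfI s_neq0) e.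
  wlog le_ij : i j id jd e / (i <= j)%N.
    by move=> W; case: (leqP i j) => [/W|/ltnW/W] ->.
  move: le_ij; rewrite leq_eqVlt => /orP[/eqP //|lt_ij].
  have l1 : q ^+ (d - j) < q ^+ (d - i) by rewrite ltr_eXn2l //; lia.
  have l2 : q ^+ i < q ^+ j by rewrite ltr_eXn2l //; lia.
  by have := ltrB l1 l2; rewrite e ltxx.
- by move=> j _; apply: krawvec_neq0.
- by move=> k kd; rewrite B_krawvec.
- by move=> k kd; rewrite Bs_krawvec.
- move=> k kd; apply: (mulf_neq0 rho_neq0); apply: mulf_neq0.
    by rewrite lt0r_neq0 // subr_gt0 -exprM exprn_egt1 //; lia.
  by rewrite invr_neq0 // lt0r_neq0 // !(mulr_gt0, addr_gt0).
- by rewrite /krawp_up subnn expr0 expr1n subrr mul0r mulr0.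
- move=> k /andP[k0 kd]; apply: (mulf_neq0 rho_neq0); apply: mulf_neq0.
    by rewrite lt0r_neq0 // subr_gt0 -exprM exprn_egt1 //; lia.
  by rewrite invr_neq0 // lt0r_neq0 // !(mulr_gt0, addr_gt0).
- by rewrite /krawp_down expr0 expr1n subrr mul0r mulr0.
Qed.
End Action.

End DualKrawtchouk.

(** * Irreducible modules *)

Lemma invariant_eigenvector (C : numClosedFieldType) (V : vectType C)
    (f : 'End(V)) (U : {vspace V}) :
  U != 0%VS -> (forall u, u \in U -> f u \in U) ->
  exists a, exists u, [/\ u \in U, u != 0 & f u = a *: u].
Proof.
move=> U0 fU; pose b := vbasis U; have bU := vbasisP U.
pose M : 'M[C]_(\dim U) := \matrix_(i, j) coord b j (f b`_i).
have [|a /eigenvalueP[v vM v0]] := @eigenvalue_closed C _ M.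
  by rewrite lt0n dimv_eq0.
have bi (i : 'I_(\dim U)) : b`_i \in U.
  by rewrite vbasis_mem // mem_nth // size_tuple.
exists a, (\sum_i v 0 i *: b`_i); split.
- by apply: rpred_sum => i _; apply: rpredZ.
- apply: contra v0 => /eqP s0; apply/eqP/rowP => i; rewrite mxE.
  by have /freeP := basis_free bU; apply.
rewrite linear_sum scaler_sumr.
under eq_bigr => i _ do
  rewrite linearZ /= (coord_basis bU (fU _ (bi i))) scaler_sumr.
rewrite exchange_big; apply: eq_bigr => j _ /=.
have := congr1 (fun r : 'rV_ _ => r 0 j) vM; rewrite !mxE => {}vM.
rewrite scalerA -vM scaler_suml; apply: eq_bigr => i _.
by rewrite scalerA mxE.
Qed.

Section UniformModules.
Variables (C : numClosedFieldType) (q g : C) (n : nat) (Rm Lm Km : 'M[C]_n).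
Variable e : 'I_n -> nat.
Hypothesis q_gt1 : 1 < q.
Hypothesis g_gt0 : 0 < g.
Hypothesis KmE : forall i (v : 'cV[C]_n), (Km *m v) i 0 = q ^- e i * v i 0.
Hypothesis KmRm : Km *m Rm = q^-1 *: (Rm *m Km).
Hypothesis KmLm : Km *m Lm = q *: (Lm *m Km).
Hypothesis cubic : Lm *m Rm *m Rm =
  (q * (q + 1)) *: (Rm *m Lm *m Rm) - q ^+ 3 *: (Rm *m Rm *m Lm)
  - ((q + 1) * g) *: Rm.

Local Notation Am := (Rm + Lm).
Local Notation T := (gen_subalg (fun B => B = Am \/ B = Km)).

Let q_gt0 : 0 < q. Proof. exact: lt_trans ltr01 q_gt1. Qed.
Let q_neq0 : q != 0. Proof. exact: lt0r_neq0. Qed.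
Let pow_inj i j : q ^+ i = q ^+ j -> i = j.
Proof. by apply: ieexprIn; rewrite // gt_eqF. Qed.
Let powV_inj i j : q ^- i = q ^- j -> i = j.
Proof. by move/invr_inj/pow_inj. Qed.

Lemma Km_eigenvalue (v : 'cV[C]_n) a :
  v != 0 -> Km *m v = a *: v -> exists i, a = q ^- e i.
Proof.
move=> v0 Kv; have /existsP[i vi] : [exists i, v i 0 != 0].
  apply: contraNT v0; rewrite negb_exists => /forallP v0.
  by apply/eqP/colP => i; rewrite mxE; apply/eqP; have := v0 i; rewrite negbK.
exists i; apply: (mulIf vi); rewrite -KmE Kv mxE //.
Qed.

Variable W : {vspace 'cV[C]_n}.
Hypothesis irrW : irreducible_module T W.

Let AmW w : w \in W -> Am *m w \in W.
Proof. by case: irrW => mW _ _; apply: mW; apply: gen_subalg_gen; left. Qed.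

Let KmW w : w \in W -> Km *m w \in W.
Proof. by case: irrW => mW _ _; apply: mW; apply: gen_subalg_gen; right. Qed.

(* [K A - q A K = (q^-1 - q) R K], and [K] maps [W] onto itself. *)
Lemma Rm_stable w : w \in W -> Rm *m w \in W.
Proof.
pose kf := linfun (@mulmx C n n 1 Km).
have kfW : (kf @: W)%VS = W.
  apply/eqP; rewrite eqEdim; apply/andP; split.
    by apply/subvP => x /memv_imgP[u uW ->]; rewrite lfunE; apply: KmW.
  rewrite limg_dim_eq //; apply/eqP; rewrite -subv0; apply/subvP => x.
  rewrite memv_cap memv_ker memv0 => /andP[_ /eqP]; rewrite lfunE /= => Kx.
  apply/eqP/colP => i; have := KmE i x; rewrite Kx !mxE => /esym/eqP.
  by rewrite mulf_eq0 invr_eq0 expf_eq0 (negPf q_neq0) andbF => /eqP.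
rewrite -{1}kfW => /memv_imgP[u uW ->]; rewrite lfunE /=.
have c0 : q^-1 - q != 0.
  rewrite subr_eq0; apply/eqP => /(congr1 (fun x => q * x)); rewrite mulfV // => e1.
  by have := @pow_inj 0 2; rewrite expr0 expr2 => /(_ e1).
have : Km *m (Am *m u) - q *: (Am *m (Km *m u)) \in W.
  by apply: rpredB; rewrite ?rpredZ //; [apply/KmW/AmW|apply/AmW/KmW].
have -> : Km *m (Am *m u) - q *: (Am *m (Km *m u)) = (q^-1 - q) *: (Rm *m (Km *m u)).
  rewrite !mulmxA mulmxDr KmRm KmLm !mulmxDl !scalerDr -!scalemxAl scalerBl.
  by rewrite opprD addrACA subrr addr0.
by rewrite rpredZeq (negPf c0).
Qed.

Lemma Lm_stable w : w \in W -> Lm *m w \in W.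
Proof.
move=> wW; have -> : Lm = Am - Rm by rewrite addrC addKr.
by rewrite mulmxBl rpredB ?Rm_stable ?AmW.
Qed.

(** Take m minimal such that q^-m is an eigenvalue of K on W. L would lower the exponent, so it
    kills this eigenspace; L R preserves it and therefore has an eigenvector there. *)
Lemma lowest_weight_vector :
  exists m, exists w, exists a,
    [/\ w \in W, w != 0, Km *m w = q ^- m *: w, Lm *m w = 0
      & Lm *m (Rm *m w) = a *: w].
Proof.
pose kf := linfun (@mulmx C n n 1 Km).
pose E m := (W :&: lker (kf - q ^- m *: \1%VF)%R)%VS.
have EP m w : (w \in E m) = (w \in W) && (Km *m w == q ^- m *: w).
  rewrite memv_cap; congr (_ && _).
  by rewrite memv_ker add_lfunE opp_lfunE scale_lfunE id_lfunE lfunE subr_eq0.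
have [m Em mmin] : exists2 m, E m != 0%VS & forall m', E m' != 0%VS -> (m <= m')%N.
  have exE : exists m, E m != 0%VS.
    have [_ W0 _] := irrW.
    have [||a [u [uW u0 fu]]] := @invariant_eigenvector C _ kf W.
    - exact/eqP.
    - by move=> u uW; rewrite lfunE; apply: KmW.
    rewrite lfunE /= in fu.
    have [i aE] := Km_eigenvalue u0 fu.
    exists (e i); apply: contraNneq u0 => E0; rewrite -memv0 -E0 EP uW fu aE.
    exact: eqxx.
  by case: (ex_minnP exE) => m Em mmin; exists m.
have LE0 w : w \in E m -> Lm *m w = 0.
  rewrite EP => /andP[wW /eqP Kw]; apply/eqP/negP => /negP Lw0.
  have KL : Km *m (Lm *m w) = (q * q ^- m) *: (Lm *m w).
    by rewrite mulmxA KmLm -scalemxAl -mulmxA Kw -scalemxAr scalerA.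
  have [i ei] := Km_eigenvalue Lw0 KL.
  have mE : m = (e i).+1.
    apply: powV_inj; apply: (mulfI q_neq0).
    by rewrite ei exprS invfM mulVKf.
  have : E (e i) != 0%VS.
    apply: contraNneq Lw0 => E0; rewrite -memv0 -E0 EP Lm_stable // KL ei.
    exact: eqxx.
  by move/mmin; rewrite mE ltnn.
have LRE w : w \in E m -> linfun (@mulmx C n n 1 (Lm *m Rm)) w \in E m.
  rewrite !EP lfunE /= => /andP[wW /eqP Kw]; rewrite -mulmxA Lm_stable ?Rm_stable //=.
  rewrite (mulmxA Km Lm) KmLm -scalemxAl -mulmxA (mulmxA Km) KmRm.
  rewrite -scalemxAl -!scalemxAr scalerA.
  by rewrite mulfV // scale1r -(mulmxA Rm) Kw -!scalemxAr.
have [a [w [wE w0 fw]]] := invariant_eigenvector Em LRE.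
rewrite lfunE /= -mulmxA in fw; have Lw := LE0 _ wE.
by move: wE; rewrite EP => /andP[wW /eqP Kw]; exists m, w, a.
Qed.


Section Raising.
Variables (m : nat) (w : 'cV[C]_n) (a : C).
Hypothesis wW : w \in W.
Hypothesis w_neq0 : w != 0.
Hypothesis Kw : Km *m w = q ^- m *: w.
Hypothesis Lw : Lm *m w = 0.
Hypothesis LRw : Lm *m (Rm *m w) = a *: w.

Definition rvec j : 'cV[C]_n := iter j (mulmx Rm) w.

Lemma rvecS j : rvec j.+1 = Rm *m rvec j. Proof. by []. Qed.

Lemma rvec_in j : rvec j \in W.
Proof. by elim: j => // j IH; rewrite rvecS Rm_stable. Qed.

Lemma Km_rvec j : Km *m rvec j = q ^- (m + j) *: rvec j.
Proof.
elim: j => [|j IH]; first by rewrite addn0.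
rewrite rvecS mulmxA KmRm -scalemxAl -mulmxA IH -scalemxAr scalerA.
by rewrite addnS exprS invfM.
Qed.

Definition tau : C := (1 - a * (q - 1) / g) / q.

(* The solutions of [y (j + 2) = q (q + 1) y (j + 1) - q^3 y j - (q + 1) g]    *)
(* with [y 0 = 0]; [tau] is chosen so that [y 1 = a].                          *)
Definition lcoef j : C := g / (q - 1) ^+ 2 * (q ^+ j - 1) * (1 - tau * q ^+ j).

Let q1_neq0 : q - 1 != 0. Proof. by rewrite subr_eq0 gt_eqF. Qed.
Let g_neq0 : g != 0. Proof. exact: lt0r_neq0. Qed.

Lemma lcoefSS j :
  lcoef j.+2 = q * (q + 1) * lcoef j.+1 - q ^+ 3 * lcoef j - (q + 1) * g.
Proof.
rewrite /lcoef !exprS; move: (q ^+ j) tau => x t.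
by field.
Qed.

(** The cubic relation applied to [rvec j] is the second order recurrence [lcoefSS], so the
    induction carries two consecutive values. *)
Lemma Lm_rvec j : Lm *m rvec j.+1 = lcoef j.+1 *: rvec j /\
  Lm *m rvec j = lcoef j *: rvec j.-1.
Proof.
elim: j => [|j [IH1 IH0]].
  split; last by rewrite Lw /lcoef expr0 subrr mulr0 mul0r scale0r.
  rewrite LRw /lcoef /tau expr1; congr (_ *: _); field.
  by rewrite q_neq0 g_neq0.
split=> //; rewrite !rvecS !mulmxA cubic !mulmxBl -!scalemxAl -!mulmxA -!rvecS IH1 IH0.
rewrite -!scalemxAr lcoefSS !scalerBl !scalerA; congr (_ - _ - _).
(* For j = 0 the predecessor [rvec j.-1] is [rvec 0], but its coefficient [lcoef 0] is 0. *)
case: j {IH1 IH0} => [|j] //.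
by rewrite /lcoef expr0 subrr !(mulr0, mul0r) !scale0r.
Qed.

(** Each nonzero [rvec j] has K-eigenvalue q^-(m + j), and these exponents are bounded by the
    largest [e i]. *)
Lemma rvec_top : exists d,
  (forall j, (j <= d)%N -> rvec j != 0) /\ rvec d.+1 = 0.
Proof.
have ex0 : exists j, rvec j == 0.
  exists (\max_i e i).+1; apply/negPn/negP => r0.
  have [i /powV_inj ei] := Km_eigenvalue r0 (Km_rvec _).
  by have := leq_bigmax (F := e) i; rewrite -ei leqNgt addnS ltnS leq_addl.
case: (ex_minnP ex0) => [[|d] /eqP rd dmin]; first by case/eqP: w_neq0.
exists d; split=> // j jd; by apply/negP => /dmin; rewrite ltnNge jd.
Qed.

Variable d : nat.
Hypothesis rvec_neq0 : forall j, (j <= d)%N -> rvec j != 0.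
Hypothesis rvec_d1 : rvec d.+1 = 0.

(** Applying L to [rvec d.+1 = 0] gives [lcoef d.+1 = 0], whose factor 1 - tau q^(d + 1) must be the
    one that vanishes. The eigenvalue [a] is thus determined by d. *)
Lemma tauE : tau = q ^- d.+1.
Proof.
have [Lr _] := Lm_rvec d; move: Lr; rewrite rvec_d1 mulmx0 => /esym/eqP.
rewrite scaler_eq0 (negPf (rvec_neq0 (leqnn d))) orbF !mulf_eq0 invr_eq0.
rewrite expf_eq0 (negPf g_neq0) (negPf q1_neq0) andbF /= => /orP[|].
  by rewrite subr_eq0 -(expr0 q) => /eqP/pow_inj.
rewrite subr_eq0 => /eqP e1; apply: (mulIf (expf_neq0 d.+1 q_neq0)).
by rewrite -e1 mulVf // expf_neq0.
Qed.

Let X := [tuple rvec i | i < d.+1].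

Let X_in i : (i <= d)%N -> rvec i \in <<X>>%VS.
Proof.
move=> id; apply: memv_span; apply/mapP; exists (inord i); rewrite ?mem_enum //.
by rewrite inordK.
Qed.

Let X_stable (B : 'M[C]_n) :
  (forall j, (j <= d)%N -> B *m rvec j \in <<X>>%VS) ->
  forall u, u \in <<X>>%VS -> B *m u \in <<X>>%VS.
Proof.
move=> BX u /coord_span ->; rewrite mulmx_sumr; apply: rpred_sum => i _.
rewrite -scalemxAr rpredZ // (nth_map i) ?size_enum_ord // nth_ord_enum.
by apply: BX; rewrite -ltnS.
Qed.

(** The span is nonzero and stable under A and K, so irreducibility leaves no other choice. *)
Lemma span_rvec : <<X>>%VS = W.
Proof.
have [mW W0 minW] := irrW.
have [|] : <<X>>%VS = 0%VS \/ <<X>>%VS = W; last by [].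
  apply: minW; first by apply/span_subvP => x /mapP[i _ ->]; apply: rvec_in.
  move=> B; elim=> [_ [->|->]| |c B1 B2 _ IH1 _ IH2|B1 B2 _ IH1 _ IH2].
  - apply: X_stable => j jd; have [_ Lj] := Lm_rvec j.
    rewrite mulmxDl -rvecS Lj; apply: rpredD; last by rewrite rpredZ ?X_in //; lia.
    case: (ltnP j d) => jd'; first exact: X_in.
    have -> : j = d by lia.
    by rewrite rvec_d1 mem0v.
  - by apply: X_stable => j jd; rewrite Km_rvec rpredZ ?X_in.
  - by move=> u uX; rewrite mul1mx.
  - by move=> u uX; rewrite mulmxDl -scalemxAl rpredD ?rpredZ ?IH1 ?IH2.
  - by move=> u uX; rewrite -mulmxA IH1 ?IH2.
move=> X0; have := X_in (leq0n d); rewrite X0 memv0.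
by rewrite (negPf (rvec_neq0 (leq0n d))).
Qed.

Lemma dim_irr : \dim W = d.+1.
Proof.
have freeX : free X.
  apply: (@free_eigenvectors _ _ _ (linfun (@mulmx C n n 1 Km))
     (fun i : 'I_d.+1 => rvec i) (fun i => q ^- (m + i))).
  - by move=> i j /powV_inj/addnI ij; apply: val_inj.
  - by move=> i; apply: rvec_neq0; rewrite -ltnS.
  - by move=> i; rewrite lfunE /= Km_rvec.
by rewrite -span_rvec; move: freeX; rewrite /free size_tuple => /eqP.
Qed.

(** Rescaling [rvec j] by [nrm j] preserves the product of the raising coefficient at j and the
    lowering one at j + 1, so this product, [lcoef j.+1], must equal sg^2 (q^d - q^j) (q^(j + 1) -
    1). This dictates the square root. *)
Let sg : C := sqrtC (g / ((q - 1) ^+ 2 * q ^+ d)).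
Let nrm j : C := \prod_(i < j) (sg * (q ^+ d - q ^+ i)).
Let bvec j : subvs_of W := vsproj W ((nrm j)^-1 *: rvec j).

Let sg_neq0 : sg != 0.
Proof.
by rewrite sqrtC_eq0 !mulf_neq0 // invr_eq0 !mulf_neq0 // expf_neq0.
Qed.

Let nrmS j : nrm j.+1 = nrm j * (sg * (q ^+ d - q ^+ j)).
Proof. by rewrite /nrm big_ord_recr. Qed.

Let nrm_neq0 j : (j <= d)%N -> nrm j != 0.
Proof.
move=> jd; apply/prodf_neq0 => i _; rewrite mulf_neq0 // subr_eq0.
by apply/eqP => /pow_inj; have := ltn_ord i; lia.
Qed.

Let bvecE j : vsval (bvec j) = (nrm j)^-1 *: rvec j.
Proof. by rewrite vsprojK // rpredZ // rvec_in. Qed.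

Let Am_bvec j : (j <= d)%N ->
  Am *m vsval (bvec j) = (sg * (q ^+ d - q ^+ j)) *: vsval (bvec j.+1)
    + (sg * (q ^+ j - 1)) *: vsval (bvec j.-1).
Proof.
move=> jd; rewrite !bvecE mulmxDl -!scalemxAr -rvecS !scalerA; congr (_ + _).
  move: jd; rewrite leq_eqVlt => /orP[/eqP ->|jd].
    by rewrite rvec_d1 !scaler0.
  congr (_ *: _); rewrite nrmS invfM mulrCA mulfV ?mulr1 //.
  by apply: contraTneq (nrm_neq0 jd) => c0; rewrite nrmS c0 mulr0 eqxx.
have [_ ->] := Lm_rvec j; rewrite scalerA; congr (_ *: _).
case: j jd => [|j] jd; first by rewrite /lcoef expr0 subrr !(mulr0, mul0r).
have sg2 : sg * sg = g / ((q - 1) ^+ 2 * q ^+ d) by rewrite -expr2 sqrtCK.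
have n0 := nrm_neq0 (ltnW jd); have n1 := nrm_neq0 jd.
have lE : lcoef j.+1 = sg * (q ^+ d - q ^+ j) * (sg * (q ^+ j.+1 - 1)).
  rewrite mulrACA sg2 /lcoef tauE !exprS.
  have := expf_neq0 d q_neq0; move: (q ^+ d) (q ^+ j) => x y x0.
  by field; rewrite x0 q1_neq0 q_neq0.
rewrite lE /= nrmS in n1 *; move: n1; rewrite mulf_eq0 negb_or => /andP[_ c0].
have aux (N c r : C) : c != 0 -> (N * c)^-1 * (c * r) = r * N^-1.
  by move=> ?; rewrite invfM -mulrA mulKf // mulrC.
exact: aux.
Qed.

Lemma raising_leonard_pair : leonard_pair (action_on W Am) (action_on W Km).
Proof.
apply: (@dual_krawtchouk_leonard_pair C q q_gt1 d _ _ _ bvec sg (q ^- m)) => //.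
- by rewrite invr_neq0 // expf_neq0.
- by rewrite dimvf -dim_irr.
- move=> j jd; apply/eqP => /(congr1 vsval); rewrite bvecE linear0 => /eqP.
  by rewrite scaler_eq0 invr_eq0 (negPf (nrm_neq0 jd)) (negPf (rvec_neq0 jd)).
- move=> j jd; apply/subvs_inj; rewrite action_onE; last exact/KmW/subvsP.
  by rewrite linearZ /= bvecE -scalemxAr Km_rvec !scalerA mulrC exprD invfM.
move=> j jd; apply/subvs_inj; rewrite action_onE; last exact/AmW/subvsP.
by rewrite Am_bvec // linearD !linearZ.
Qed.
End Raising.

Lemma irreducible_module_leonard_pair :
  leonard_pair (action_on W Am) (action_on W Km).
Proof.
have [m [w [a [wW w0 Kw Lw LRw]]]] := lowest_weight_vector.
have [d [r0 rd]] := rvec_top w0 Kw.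
exact (raising_leonard_pair wW w0 Kw Lw LRw r0 rd).
Qed.

End UniformModules.

(** * The Attenuated Space poset as an instance *)

Lemma attenuated_leonard_pair (C : numClosedFieldType) (F : finFieldType)
    (H : vectType F) (h : {vspace H}) (W : {vspace 'cV[C]_#|{: attSpace h}|}) :
  irreducible_module
    (gen_subalg (fun B => B = att_mx h C \/ B = att_dual_mx h C)) W ->
  leonard_pair (action_on W (att_mx h C)) (action_on W (att_dual_mx h C)).
Proof.
rewrite att_mx_split => irrW.
apply: (@irreducible_module_leonard_pair C #|F|%:R (#|F|%:R ^+ \dim {:H}) _
  (raising_mx h C) (lowering_mx h C) (att_dual_mx h C)
  (fun i => \dim (aval (enum_val i)))) => //.
- by rewrite (ltr_nat C 1) card_field_gt1.
- by rewrite exprn_gt0 // ltr0n ltnW // card_field_gt1.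
- by move=> i v; rewrite att_dual_mulE.
- exact: dual_raising.
- exact: dual_lowering.
- exact: lowering_raising_cubic.
Qed.

Theorem mainTheorem7 (R : realType) (F : finFieldType) (N M : nat)
    (H : vectType F) (h : {vspace H}) :
  (0 < N)%N -> (0 < M)%N -> \dim {:H} = (N + M)%N -> \dim h = M ->
  let A : 'M[R[i]]_#|{: attSpace h}| := att_mx h R[i] in
  let As : 'M[R[i]]_#|{: attSpace h}| := att_dual_mx h R[i] in
  let T := gen_subalg (fun B => B = A \/ B = As) in
  forall W : {vspace 'cV[R[i]]_#|{: attSpace h}|},
    irreducible_module T W ->
    leonard_pair (action_on W A) (action_on W As).
Proof.
by move=> _ _ _ _ A As T W; apply: attenuated_leonard_pair.
Qed.
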